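(* Let $n,k$ be positive integers such that $n\ge 8k$, and let $i\in\{1,\ldots,n\}$. If $H\sim\text{Hyp}(n,i,k)$, then \[ \mathbb{P}\left(H \ge \mathbb{E}(H)\right) \,\ge\, \frac{k}{n}. \]
   Context: For positive integers $n\ge k$ and $i\in\{1,\ldots,n\}$, $\text{Hyp}(n,i,k)$ denotes the hypergeometric distribution: the number of black marbles in a sample without replacement of size $k$ from an urn with $i$ black and $n-i$ white marbles, i.e. $\mathbb{P}(H=j)=\binom{i}{j}\binom{n-i}{k-j}/\binom{n}{k}$ for $j\in\{\max\{0,k-(n-i)\},\ldots,\min\{k,i\}\}$. Its mean is $\mathbb{E}(H)=ik/n$. *)

(* Defs.v *)
From mathcomp Require Import all_boot all_order all_algebra.
Set Implicit Arguments. Unset Strict Implicit. Unset Printing Implicit Defensive.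
Import Order.TTheory GRing.Theory Num.Theory.
Local Open Scope ring_scope.

(* Hypergeometric distribution Hyp(n,i,k): P(H = j) for 0 <= j <= k,
   = C(i,j) C(n-i,k-j) / C(n,k).  (For j outside the support the binomials
   vanish; j ranges over 0..k so truncated subtraction k-j is exact.) *)
Definition hyp_pmf (R : realFieldType) (n i k j : nat) : R :=
  ('C(i, j) * 'C(n - i, k - j))%:R / ('C(n, k))%:R.

(* P(H >= E H) with E H = i k / n, i.e. j >= i k / n <=> i*k <= j*n (n > 0). *)
Definition hyp_prob_ge_mean (R : realFieldType) (n i k : nat) : R :=
  \sum_(j < k.+1 | (i * k <= j * n)%N) hyp_pmf R n i k j.

(* Main.v *)
Require Import Defs.
From mathcomp Require Import all_boot all_order all_algebra.
From mathcomp Require Import zify ring lra.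
Import Order.TTheory GRing.Theory Num.Theory.

(** Let [m] be the integer with [m < E(H) <= m + 1].  If [m = 0], then
    [P(H >= 1)] is smallest at [i = 1], where it equals [k / n].

    If [m >= 1], then [P(H >= m + 1) >= 1/8].  Put [a = P(H = m)],
    [s = P(H < m)], [q = P(H > m)].  Log-concavity of the distribution
    [p] gives [p_m p_(m+u+v) <= p_(m+u) p_(m+v)], and summing over [u >= 1] and
    [v >= 0] gives [a E(H - m)^+ <= q (q + a)].  Since [p] is nondecreasing up
    to [m], [2 a E(H - m)^- >= s (s + a)].  As [E(H) >= m], it follows that
    [s (s + a) <= 2 q (q + a)].  Finally [n >= 8 k] yields
    [p_(m+1) / p_m >= 7/16], so [7 a <= 16 q], and the two inequalities force
    [a + s <= 7 q]. *)

(** * Hypergeometric counts: log-concavity, mean and consecutive ratios *)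

Local Open Scope nat_scope.

Lemma bin_log_concave n a b :
  a <= b -> 'C(n, a) * 'C(n, b.+1) <= 'C(n, a.+1) * 'C(n, b).
Proof.
move=> leab; rewrite -(leq_pmul2l (ltn0Sn a)) -(leq_pmul2l (ltn0Sn b)).
have Ea := mul_bin_left n a; have Eb := mul_bin_left n b.
have -> : b.+1 * (a.+1 * ('C(n, a) * 'C(n, b.+1))) =
  a.+1 * 'C(n, a) * (b.+1 * 'C(n, b.+1)) by lia.
have -> : b.+1 * (a.+1 * ('C(n, a.+1) * 'C(n, b))) =
  (a.+1 * 'C(n, a.+1)) * (b.+1 * 'C(n, b)) by lia.
rewrite Ea Eb.
have -> : a.+1 * 'C(n, a) * ((n - b) * 'C(n, b)) =
  (a.+1 * (n - b)) * ('C(n, a) * 'C(n, b)) by lia.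
have -> : (n - a) * 'C(n, a) * (b.+1 * 'C(n, b)) =
  ((n - a) * b.+1) * ('C(n, a) * 'C(n, b)) by lia.
by apply: leq_mul => //; rewrite mulnC; apply: leq_mul; lia.
Qed.

(* The factor [j <= k] discards the values at [j > k], where the truncated
   subtraction [k - j] would make the product of binomials nonzero. *)
Definition hyp_count n i k j := (j <= k) * ('C(i, j) * 'C(n - i, k - j)).

(** Binomial rows are log-concave, also when reversed by [j -> k - j], and products inherit this.
    For [b >= k] the left side is 0. *)
Lemma hyp_count_log_concave n i k a b : a <= b ->
  hyp_count n i k a * hyp_count n i k b.+1 <=
  hyp_count n i k a.+1 * hyp_count n i k b.
Proof.
move=> leab; rewrite /hyp_count; case: (ltnP b k) => [ltbk | _]; last by lia.
rewrite (leq_trans leab (ltnW ltbk)) (leq_ltn_trans leab ltbk) (ltnW ltbk) !mul1n.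
have := @bin_log_concave (n - i) (k - b.+1) (k - a.+1) ltac:(lia).
rewrite !subnSK ?(leq_ltn_trans leab) // => h.
rewrite mulnACA [leqRHS]mulnACA leq_mul ?bin_log_concave //.
by rewrite mulnC [leqRHS]mulnC.
Qed.

Lemma hyp_count_ratio n i k j c d : j < k ->
    c * (j.+1 * (n - i - (k - j.+1))) <= d * ((i - j) * (k - j)) ->
  c * hyp_count n i k j <= d * hyp_count n i k j.+1.
Proof.
move=> ltjk; rewrite /hyp_count ltjk (ltnW ltjk) !mul1n.
have Ei := mul_bin_left i j; have := mul_bin_left (n - i) (k - j.+1).
rewrite subnSK // => Ew.
case: (posnP (n - i - (k - j.+1))) => [le0 _|gt0 le_cd].
  (* Here [n - i < k - j], so the count at [j] vanishes. *)
  by rewrite [X in _ * (_ * X)]bin_small; lia.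
have pos : 0 < j.+1 * (n - i - (k - j.+1)) by rewrite muln_gt0.
rewrite -(leq_pmul2l pos).
set D := n - i - _ in Ew le_cd *; move: Ei Ew le_cd.
move: 'C(i, j) 'C(i, j.+1) 'C(n - i, k - j) 'C(n - i, k - j.+1) => x x' y y' Ei Ew le_cd.
have -> : j.+1 * D * (d * (x' * y')) = d * ((j.+1 * x') * (D * y')) by lia.
rewrite Ei -Ew.
have -> : d * ((i - j) * x * ((k - j) * y)) = d * ((i - j) * (k - j)) * (x * y) by lia.
have -> : j.+1 * D * (c * (x * y)) = c * (j.+1 * D) * (x * y) by lia.
by rewrite leq_mul.
Qed.

Lemma sum_hyp_count n i k : i <= n -> \sum_(j < k.+1) hyp_count n i k j = 'C(n, k).
Proof.
move=> lein; rewrite -[in RHS](subnKC lein) -binomial.Vandermonde.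
by apply: eq_bigr => j _; rewrite /hyp_count -ltnS ltn_ord mul1n.
Qed.

(** Absorption, [j C(i,j) = i C(i-1,j-1)], turns the sum into the total count for [n-1], [i-1],
    [k-1]. *)
Lemma hyp_count_mean n i k : i <= n ->
  n * \sum_(j < k.+1) j * hyp_count n i k j = i * k * 'C(n, k).
Proof.
case: k => [|k] lein; first by rewrite big_ord1 /= !muln0.
case: i => [|i] in lein *.
  rewrite mul0n big1 ?muln0 // => -[[|j] ltj] _ //.
  by rewrite /hyp_count bin0n /= mul0n !muln0.
case: n => // n in lein *.
rewrite -mulnA -mul_bin_diag mulnCA; congr (_ * _).
rewrite big_ord_recl mul0n add0n -(@sum_hyp_count n i k) // big_distrr.
apply: eq_bigr => j _; rewrite /hyp_count /= /bump /= add1n !subSS !ltnS.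
have /= := mul_bin_diag i.+1 j; nia.
Qed.

(** If the mean is at least [m], then outside a sample with [m] black marbles at least the share
    [m/k] of the [n - k] marbles is black; [white_deficit] is the matching bound for white. *)
Lemma black_excess n i k m :
  m * n <= i * k -> m * (n - k) <= k * (i - m).
Proof. by rewrite !mulnBr [k * i]mulnC [k * m]mulnC => /leq_sub2r->. Qed.

Lemma white_deficit n i k m :
  m * n <= i * k -> k * (n - i - (k - m)) <= (k - m) * (n - k).
Proof.
move=> lemn; rewrite [leqRHS]mulnBr [k * _]mulnBr.
rewrite [(k - m) * k]mulnC leq_sub2r // mulnBr mulnBl leq_sub2l //.
by rewrite [k * i]mulnC.
Qed.

Lemma hyp_count_nondecreasing n i k j :
    0 < k <= n -> j < k -> j.+1 * n <= i * k ->
  hyp_count n i k j <= hyp_count n i k j.+1.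
Proof.
move=> /andP[k0 lekn] ltjk lejn.
have := @hyp_count_ratio n i k j 1 1 ltjk; rewrite !mul1n; apply.
rewrite -(leq_pmul2l k0).
have leA := @black_excess n i k j.+1 lejn; have leD := @white_deficit n i k j.+1 lejn.
apply: (@leq_trans (j.+1 * ((k - j.+1) * (n - k)))).
  by rewrite mulnCA leq_mul2l leD orbT.
have : j.+1 * (n - k) * (k - j.+1) <= k * (i - j) * (k - j).
  by apply: leq_mul; [apply: leq_trans leA _; rewrite leq_mul2l; lia | lia].
by move: (n - k) (k - j.+1) (i - j) (k - j); lia.
Qed.

(** The factor 16/7 is 2 times 8/7: [m + 1 <= 2 m] gives the 2, and the shift from [k - m] to
    [k - m.+1] adds at most [k], which is at most a seventh of [(k - m) * (n - k)]. *)
Lemma hyp_count_step n i k m :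
    0 < m < k -> 8 * k <= n -> m * n <= i * k ->
  7 * hyp_count n i k m <= 16 * hyp_count n i k m.+1.
Proof.
move=> /andP[m0 ltmk] le8 lemn; apply: hyp_count_ratio => //.
have k0 : 0 < k by lia.
rewrite -(leq_pmul2l k0).
have leA := @black_excess n i k m lemn; have leD := @white_deficit n i k m lemn.
move: leA leD; have : n - i - (k - m.+1) <= (n - i - (k - m)).+1 by lia.
move: (n - i - (k - m)) (n - i - (k - m.+1)) (i - m) => D D' A leD' leA leD.
have {leD'} leD' : k * D' <= (k - m) * (n - k) + k by nia.
have h1 : m.+1 * (k * D') <= (2 * m) * ((k - m) * (n - k) + k).
  by apply: leq_mul => //; lia.
have h2 : 7 * k <= (k - m) * (n - k) by nia.
have h3 : m * (n - k) * (k - m) <= k * A * (k - m) by rewrite leq_mul.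
have h4 : m * (7 * k) <= m * ((k - m) * (n - k)) by rewrite leq_mul.
move: (k - m) (n - k) h1 h2 h3 h4 => W N; nia.
Qed.

(** * Moment inequalities for log-concave sequences *)

Local Open Scope ring_scope.

Definition log_concave {R : numDomainType} (f : nat -> R) :=
  forall a b, (a <= b)%N -> f a * f b.+1 <= f a.+1 * f b.

Lemma log_concave_shift {R : numDomainType} {f : nat -> R} m :
  log_concave f -> log_concave (fun t => f (m + t)%N).
Proof. by move=> lcf a b leab; rewrite !addnS lcf ?leq_add2l. Qed.

Lemma log_concave_inward {R : numDomainType} {f : nat -> R} u v a :
  log_concave f -> f a * f (a + u + v)%N <= f (a + u)%N * f (a + v)%N.
Proof.
move=> lcf; elim: v u a => [|v IHv] [|u] a; rewrite ?addn0 //.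
  by rewrite mulrC.
rewrite addnS; apply: le_trans (lcf a (a + u.+1 + v)%N _) _.
  by rewrite -addnA leq_addr.
by rewrite addnS -!addSn mulrC -addSnnS; have := IHv u a.+1; rewrite mulrC !addSn -!addnS.
Qed.

(** The weight [t] counts the ways to write [t = u.+1 + v]. *)
Lemma sum_mul_index {R : pzSemiRingType} (y : nat -> R) w :
  \sum_(t < w.+1) t%:R * y t =
  \sum_(u < w) \sum_(v < (w - u)%N) y (u.+1 + v)%N.
Proof.
elim: w => [|w IHw]; first by rewrite big_ord1 big_ord0 mul0r.
rewrite big_ord_recr IHw big_ord_recr /= subSnn big_ord1 addn0.
have -> : \sum_(u < w) \sum_(v < (w.+1 - u)%N) y (u.+1 + v)%N =
    \sum_(u < w) (\sum_(v < (w - u)%N) y (u.+1 + v)%N + y w.+1).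
  apply: eq_bigr => u _; rewrite subSn 1?ltnW // big_ord_recr /=.
  by rewrite addSn subnKC // ltnW.
by rewrite big_split sumr_const card_ord /= -addrA -mulrSr mulr_natl.
Qed.

Lemma log_concave_upper_moment {R : numDomainType} (y : nat -> R) w :
    (forall t, 0 <= y t) -> log_concave y ->
  y 0%N * (\sum_(t < w.+1) t%:R * y t) <=
  (\sum_(t < w) y t.+1) * (\sum_(t < w.+1) y t).
Proof.
move=> y0 lcy; rewrite sum_mul_index mulr_sumr mulr_suml.
apply: ler_sum => u _; rewrite mulr_sumr.
apply: (@le_trans _ _ (\sum_(v < (w - u)%N) y u.+1 * y v)).
  apply: ler_sum => v _; exact: (log_concave_inward u.+1 v 0%N lcy).
rewrite -mulr_sumr ler_wpM2l // (big_ord_widen w.+1) ?big_mkcond; last by rewrite ltnW // ltnS leq_subr.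
by apply: ler_sum => v _; case: ifP.
Qed.

(** Equality holds when all [x j = a]. The induction strips [x 0], of largest weight; the left side
    then grows by [x 0 * (2 S + x 0 + a)], where the remaining sum [S] is at most [m a]. *)
Lemma bounded_lower_moment {R : realDomainType} (x : nat -> R) a m :
    (forall j, (j < m)%N -> 0 <= x j <= a) ->
  (\sum_(j < m) x j) * (\sum_(j < m) x j + a) <=
  2 * a * \sum_(j < m) (m - j)%:R * x j.
Proof.
elim: m x => [|m IHm] x xP; first by rewrite !big_ord0 mul0r mulr0.
rewrite !big_ord_recl subn0 /=.
have {}IHm := IHm (fun j => x j.+1) (fun j lt_jm => xP j.+1 lt_jm).
have le_sum : \sum_(j < m) x j.+1 <= m%:R * a.
  rewrite mulr_natl -[m in a *+ m]card_ord -sumr_const.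
  by apply: ler_sum => j _; have /andP[] := xP j.+1 (ltn_ord j).
have /andP[x0 xa] := xP 0%N isT.
under [X in _ <= _ * (_ + X)]eq_bigr do rewrite /bump add1n subSS.
move: IHm le_sum; set S := \sum_(i < m) _; set T := \sum_(i < m) _ => IHm le_sum.
rewrite -natr1.
have : x 0%N * (2 * S + x 0%N + a) <= x 0%N * (2 * (m%:R + 1) * a).
  by apply: ler_wpM2l => //; lra.
rewrite -/S; nra.
Qed.

Lemma log_concave_tail_ge (R : realDomainType) (f : nat -> R) m w :
    (forall j, 0 <= f j) -> log_concave f ->
    (forall j, (j < m)%N -> f j <= f j.+1) ->
    7 * f m <= 16 * f m.+1 -> (0 < w)%N ->
    m%:R * (\sum_(j < m + w.+1) f j) <= \sum_(j < m + w.+1) j%:R * f j ->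
  \sum_(j < m + w.+1) f j <= 8 * \sum_(t < w) f (m + t.+1)%N.
Proof.
move=> f0 lcf incf ratio w0 mean.
have lef j : (j < m)%N -> 0 <= f j <= f m.
  rewrite f0 /= => ltjm.
  have -> : m = (j + (m - j))%N by lia.
  have: (j + (m - j) <= m)%N by lia.
  elim: (m - j)%N => [|t IHt] lejt; first by rewrite addn0.
  by rewrite addnS (le_trans (IHt _) (incf _ _)) //; lia.
have := @bounded_lower_moment _ f (f m) m lef.
have := @log_concave_upper_moment _ (fun t => f (m + t)%N) w (fun t => f0 _)
  (log_concave_shift m lcf).
rewrite /= addn0.
move: mean; rewrite !big_split_ord /= !mulrDr.
have -> : \sum_(t < w.+1) (m + t)%:R * f (m + t)%N =
    m%:R * \sum_(t < w.+1) f (m + t)%N + \sum_(t < w.+1) t%:R * f (m + t)%N.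
  by rewrite mulr_sumr -big_split; apply: eq_bigr => t _; rewrite natrD mulrDl.
have -> : \sum_(j < m) j%:R * f j =
    m%:R * (\sum_(j < m) f j) - \sum_(j < m) (m - j)%:R * f j.
  rewrite mulr_sumr -sumrB; apply: eq_bigr => j _.
  by rewrite natrB 1?ltnW // -mulrBl; congr (_ * _); ring.
have -> : \sum_(t < w.+1) f (m + t)%N = f m + \sum_(t < w) f (m + t.+1)%N.
  by rewrite big_ord_recl addn0.
have s0 : 0 <= \sum_(j < m) f j by apply: sumr_ge0.
have leq1 : f m.+1 <= \sum_(t < w) f (m + t.+1)%N.
  case: w w0 => // w _; rewrite big_ord_recl addn1 lerDl.
  by apply: sumr_ge0.
move: s0 leq1 (f0 m) (f0 m.+1) ratio.
set s := \sum_(j < m) f j; set q := \sum_(t < w) f _.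
set Ep := \sum_(t < w.+1) t%:R * _; set Em := \sum_(j < m) (m - j)%:R * _.
move: (f m) (f m.+1) => a b s0 leq1 a0 b0 ratio mean up low.
(* The multiples of [m] cancel, leaving [E(H - m) >= 0]. *)
have {}mean : Em <= Ep by lra.
have key : s * s + s * a <= 2 * (q * (a + q)).
  apply: le_trans low _; rewrite -mulrA ler_wpM2l //.
  by apply: (le_trans _ up); rewrite ler_wpM2l.
(* Otherwise [s (s + a) > 2 q (2 q + a) >= 2 q (q + a)], against [key]. With [7 a <= 16 q] the total
   [s + a + q] is then at most [(2 + 16/7 + 1) q]. *)
have les : s <= 2 * q.
  rewrite leNgt; apply/negP => lt2qs.
  have : 2 * q * (2 * q + a) < s * (s + a) by nra.
  nra.
lra.
Qed.

(** * Tail bounds for the counts and the theorem *)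

Lemma hyp_count_tail_ge n i k m :
    (0 < m < k)%N -> (8 * k <= n)%N -> (i <= n)%N -> (m * n <= i * k)%N ->
  ('C(n, k) <= 8 * \sum_(t < k - m) hyp_count n i k (m + t.+1))%N.
Proof.
move=> /[dup] mP /andP[m0 ltmk] le8 lein lemn.
(* The moment argument subtracts, so the counts move to [int]. *)
pose f j : int := (hyp_count n i k j)%:R.
have Ek : (m + (k - m).+1 = k.+1)%N by lia.
rewrite -(ler_nat int) natrM -(sum_hyp_count n i k lein) !natr_sum -Ek.
apply: (@log_concave_tail_ge _ f); rewrite /f.
- by [].
- by move=> a b leab; rewrite -!natrM ler_nat hyp_count_log_concave.
- move=> j ltjm; rewrite ler_nat hyp_count_nondecreasing //; try lia.
  by apply: leq_trans lemn; rewrite leq_mul2r ltjm orbT.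
- by rewrite -!natrM ler_nat hyp_count_step.
- by rewrite subn_gt0.
rewrite Ek; under [leRHS]eq_bigr do rewrite -natrM.
rewrite -!natr_sum sum_hyp_count // -natrM ler_nat.
have n0 : (0 < n)%N by lia.
rewrite -(leq_pmul2l n0) hyp_count_mean // mulnA leq_mul2r [(n * m)%N]mulnC.
by rewrite lemn orbT.
Qed.

(** The count at 0 is at most [C(n-1,k)], its value for [i = 1]; by Pascal's rule at least
    [C(n-1,k-1) = (k/n) C(n,k)] remains. *)
Lemma hyp_count_positive_ge n i k :
    (0 < k)%N -> (1 <= i <= n)%N ->
  (k * 'C(n, k) <= n * \sum_(t < k) hyp_count n i k t.+1)%N.
Proof.
move=> k0 /andP[i0 lein].
have total : ('C(n - i, k) + \sum_(t < k) hyp_count n i k t.+1 = 'C(n, k))%N.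
  by rewrite -(sum_hyp_count n i k) // big_ord_recl
    {2}/hyp_count subn0 bin0 !mul1n.
case: n i0 lein total => [|n] i0 lein total; first by lia.
have := @leq_bin2l (n.+1 - i) n k.
case: k k0 total => // k _ total /(_ ltac:(lia)).
rewrite -mul_bin_diag leq_mul2l /= => le_white.
by rewrite -(leq_add2l 'C(n.+1 - i, k.+1)) total binS leq_add2r.
Qed.

Lemma hyp_prob_ge_mean_tail (R : realFieldType) n i k m :
    (m < k)%N -> (i * k <= m.+1 * n)%N ->
  (\sum_(t < k - m) hyp_count n i k (m + t.+1))%:R / 'C(n, k)%:R
    <= hyp_prob_ge_mean R n i k.
Proof.
move=> ltmk lemn; rewrite /hyp_prob_ge_mean.
have Ek : k.+1 = (m.+1 + (k - m))%N by lia.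
rewrite [in leRHS]Ek big_split_ord /= natr_sum mulr_suml.
rewrite ler_wpDl //.
  by apply: sumr_ge0 => j _; rewrite divr_ge0.
rewrite [leRHS]big_mkcond; apply: ler_sum => t _.
have -> : (i * k <= (m.+1 + t) * n)%N
  by rewrite (leq_trans lemn) // leq_mul2r leq_addr orbT.
rewrite /hyp_count /hyp_pmf addSnnS;
have -> : (m + t.+1 <= k)%N by have := ltn_ord t; lia.
by rewrite mul1n.
Qed.

Theorem theorem1 (R : realFieldType) (n k i : nat) :
  (0 < k)%N -> (8 * k <= n)%N -> (1 <= i <= n)%N ->
  (k%:R / n%:R : R) <= hyp_prob_ge_mean R n i k.
Proof.
move=> k0 le8 /[dup] iP /andP[i0 lein].
have n0 : (0 < n)%N by lia.
(* The predecessor makes [m] lie strictly below the mean, so an integral mean equals [m + 1]. *)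
pose m := ((i * k).-1 %/ n)%N.
have ik0 : (0 < i * k)%N by rewrite muln_gt0 i0.
have lemn : (m * n < i * k)%N by have := leq_trunc_div (i * k).-1 n; lia.
have gtmn : (i * k <= m.+1 * n)%N by have := ltn_ceil (i * k).-1 n0; lia.
have ltmk : (m < k)%N.
  by rewrite -(ltn_pmul2r n0) (leq_trans lemn) // mulnC leq_mul2l lein orbT.
apply: le_trans (hyp_prob_ge_mean_tail R n i k m ltmk gtmn).
have C0 : (0 < 'C(n, k))%N by rewrite bin_gt0; lia.
rewrite ler_pdivrMr ?ltr0n // mulrAC ler_pdivlMr ?ltr0n // -!natrM ler_nat.
have [m0|m0] := posnP m.
  by rewrite m0 subn0 [leqRHS]mulnC hyp_count_positive_ge.
have mP : (0 < m < k)%N by rewrite m0.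
(* The tail has probability at least 1/8, and [k/n <= 1/8]. *)
have := hyp_count_tail_ge n i k m mP le8 lein (ltnW lemn).
set T := (\sum_(t < _) _)%N; nia.
Qed.
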